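(* Let $G=\mathrm{SL}(2,\mathbf Z)$ and let $V$ be the standard $2$-dimensional $\mathbf CG$-module. There exists a $T$-indecomposable $\mathbf CG$-module $M$ having an ascending filtration $0=M_0\subseteq M_1\subseteq M_2\subseteq\cdots$ by $\mathbf CG$-submodules with $M=\bigcup_n M_n$ and $M_n/M_{n-1}\cong V$ for all $n\in\mathbf N$; and any two $T$-indecomposable $\mathbf CG$-modules having such a filtration are isomorphic.
   Context: $T=\begin{pmatrix}1&1\\0&1\end{pmatrix}$. A $\mathbf CG$-module is called $T$-indecomposable if $T$ acts indecomposably and unipotently on every $T$-invariant subspace. (The paper identifies the module in question as $M_\infty$, the space $E$ with basis $e_1,e_2,\dots$ on which $G$ acts by a representation $\tau$ with $\tau(T)$ the infinite Jordan block and filtration $E_i=\mathrm{span}(e_1,\dots,e_{2i})$.) *)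

(* Defs.v *)
From HB Require Import structures.
From mathcomp Require Import all_boot all_order all_algebra.
From mathcomp Require Import complex Rstruct.
From Stdlib Require Rdefinitions.
Set Implicit Arguments. Unset Strict Implicit. Unset Printing Implicit Defensive.
Import Order.TTheory GRing.Theory Num.Theory.
Local Open Scope ring_scope.

Definition CC : numClosedFieldType := (Rdefinitions.R)[i].

Definition SL2Z := { A : 'M[int]_2 | \det A == 1 }.

Lemma SL2Z_mul_proof (g h : SL2Z) : \det (proj1_sig g *m proj1_sig h) == 1.
Proof.
case: g h => [A hA] [B hB] /=.
by rewrite det_mulmx (eqP hA) (eqP hB) mulr1.
Qed.

Lemma SL2Z_one_proof : \det (1%:M : 'M[int]_2) == 1.
Proof. by rewrite det1. Qed.

Definition SL2Z_mul (g h : SL2Z) : SL2Z :=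
  exist _ (proj1_sig g *m proj1_sig h) (SL2Z_mul_proof g h).
Definition SL2Z_one : SL2Z := exist _ 1%:M SL2Z_one_proof.

Definition Tmx : 'M[int]_2 :=
  \matrix_(i < 2, j < 2) (if (i == j) || ((i == 0 :> nat) && (j == 1 :> nat)) then 1 else 0).

Lemma Tmx_det : \det Tmx == 1.
Proof.
rewrite -det_tr det_trig; last first.
  apply/is_trig_mxP => -[[|[|i]] Hi] [[|[|j]] Hj] //= _; by rewrite !mxE.
by rewrite !big_ord_recl big_ord0 !mxE.
Qed.

Definition T : SL2Z := exist _ Tmx Tmx_det.

Definition is_CGmodule (M : lmodType CC) (rho : SL2Z -> M -> M) : Prop :=
  [/\ (forall g (a : CC) (x y : M), rho g (a *: x + y) = a *: rho g x + rho g y),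
      (forall x, rho SL2Z_one x = x) &
      (forall g h x, rho (SL2Z_mul g h) x = rho g (rho h x))].

Definition Vstd := 'cV[CC]_2.
Definition std_act (g : SL2Z) (v : Vstd) : Vstd :=
  map_mx (fun z : int => z%:~R : CC) (proj1_sig g) *m v.

Definition subspace (M : lmodType CC) (W : M -> Prop) : Prop :=
  W 0 /\ forall (a : CC) x y, W x -> W y -> W (a *: x + y).

Definition invariant (M : lmodType CC) (f : M -> M) (W : M -> Prop) : Prop :=
  forall x, W x -> W (f x).

Definition CGsubmodule (M : lmodType CC) (rho : SL2Z -> M -> M) (W : M -> Prop) :=
  subspace W /\ forall g, invariant (rho g) W.

Definition direct_sum (M : lmodType CC) (W W1 W2 : M -> Prop) : Prop :=
  (forall x, W x <-> exists x1 x2, [/\ W1 x1, W2 x2 & x = x1 + x2]) /\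
  (forall x, W1 x -> W2 x -> x = 0).

Definition acts_indecomposably (M : lmodType CC) (f : M -> M) (W : M -> Prop) :=
  forall W1 W2 : M -> Prop,
    subspace W1 -> subspace W2 -> invariant f W1 -> invariant f W2 ->
    direct_sum W W1 W2 ->
    (forall x, W1 x -> x = 0) \/ (forall x, W2 x -> x = 0).

Definition acts_unipotently (M : lmodType CC) (f : M -> M) (W : M -> Prop) :=
  forall x, W x -> exists k : nat, iter k (fun y => f y - y) x = 0.

Definition T_indecomposable (M : lmodType CC) (rho : SL2Z -> M -> M) : Prop :=
  forall W : M -> Prop, subspace W -> invariant (rho T) W ->
    acts_indecomposably (rho T) W /\ acts_unipotently (rho T) W.

(** The quotient CG-module W / U (with U <= W submodules of M) is isomorphic
    to V: there is a C-linear, G-equivariant map W -> V, onto, with kernel U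
    (first isomorphism theorem). *)
Definition quotient_iso_V (M : lmodType CC) (rho : SL2Z -> M -> M)
    (W U : M -> Prop) : Prop :=
  exists f : M -> Vstd,
    [/\ (forall (a : CC) x y, W x -> W y -> f (a *: x + y) = a *: f x + f y),
        (forall g x, W x -> f (rho g x) = std_act g (f x)),
        (forall v, exists2 x, W x & f x = v) &
        (forall x, W x -> (f x = 0 <-> U x))].

Definition V_filtration (M : lmodType CC) (rho : SL2Z -> M -> M)
    (Mn : nat -> M -> Prop) : Prop :=
  [/\ (forall n, CGsubmodule rho (Mn n)),
      (forall x, Mn 0%N x <-> x = 0),
      (forall n x, Mn n x -> Mn n.+1 x),
      (forall x, exists n, Mn n x) &
      (forall n, quotient_iso_V rho (Mn n.+1) (Mn n))].

Definition has_V_filtration (M : lmodType CC) (rho : SL2Z -> M -> M) : Prop :=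
  exists Mn : nat -> M -> Prop, V_filtration rho Mn.

Definition CGiso (M1 M2 : lmodType CC) (rho1 : SL2Z -> M1 -> M1)
    (rho2 : SL2Z -> M2 -> M2) (f : M1 -> M2) : Prop :=
  [/\ (forall (a : CC) x y, f (a *: x + y) = a *: f x + f y),
      bijective f &
      (forall g x, f (rho1 g x) = rho2 g (f x))].

(* Main.v *)
Require Import Defs.
From mathcomp Require Import all_boot all_order all_algebra.
From mathcomp Require Import complex Rstruct.
From mathcomp Require Import zify ring.
From mathcomp Require Import boolp.

Set Implicit Arguments. Unset Strict Implicit. Unset Printing Implicit Defensive.
Import Order.TTheory GRing.Theory Num.Theory.
Local Open Scope ring_scope.

(** Write S = [[0,-1],[1,0]] and U = [[0,-1],[1,1]], so that S^2 = U^3 = -1 and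
    T = - S U. On a module M filtered by copies of V, induction along the
    filtration gives S^2 = -1 and U^2 = U - 1, and then z = T + T^-1 - 2 commutes
    with S and U and lowers the filtration. Let L be the i-eigenspace of S. Since
    T - 1 has a one-dimensional kernel, so has z on L, which forces z to be onto L:
    thus L is C[X] with z acting by 'X^(n+1) |-> 'X^n, 1 |-> 0. The relations express
    S (p + U q) and U (p + U q), for p and q in L, through z alone, and p + U q runs
    bijectively over M because 1 + 4 z + z^2 is invertible (z is locally nilpotent).
    Hence M is determined up to isomorphism. Conversely these formulas define
    operators on C[X]^2 satisfying S^4 = 1 and U^3 = S^2, which by the presentation
    of SL(2,Z) extend to an action of SL(2,Z). The presentation is obtained by
    ping-pong: up to sign S U and S U^2 are the two elementary positive matrices,
    so that no nonempty reduced word is the identity. *)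

(** * The presentation of SL(2,Z) *)

Definition mx2 (R : Type) (a b c d : R) : 'M[R]_2 :=
  \matrix_(i, j) if i == 0 then if j == 0 then a else b
                 else if j == 0 then c else d.

Lemma mx2_inj (R : Type) (a b c d a' b' c' d' : R) :
  mx2 a b c d = mx2 a' b' c' d' -> [/\ a = a', b = b', c = c' & d = d'].
Proof.
move=> /matrixP e.
by move: (e 0 0) (e 0 1) (e 1 0) (e 1 1); rewrite !mxE.
Qed.

Lemma mx2_eta (R : Type) (A : 'M[R]_2) : A = mx2 (A 0 0) (A 0 1) (A 1 0) (A 1 1).
Proof.
apply/matrixP=> i j; rewrite mxE.
case: i => [[|[|i]] hi] //; case: j => [[|[|j]] hj] //=;
by congr (A _ _); apply: val_inj.
Qed.

Lemma mx2_mul (R : pzRingType) (a b c d a' b' c' d' : R) :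
  mx2 a b c d *m mx2 a' b' c' d' =
  mx2 (a * a' + b * c') (a * b' + b * d') (c * a' + d * c') (c * b' + d * d').
Proof. by rewrite [LHS]mx2_eta !mxE !big_ord_recl !big_ord0 !mxE /= !addr0. Qed.

Lemma mx2_opp (R : zmodType) (a b c d : R) :
  - mx2 a b c d = mx2 (- a) (- b) (- c) (- d).
Proof. by rewrite [LHS]mx2_eta !mxE. Qed.

Lemma mx2_1 (R : pzRingType) : 1%:M = mx2 1 0 0 1 :> 'M[R]_2.
Proof. by rewrite [LHS]mx2_eta !mxE. Qed.

Lemma mx2_det (R : comPzRingType) (a b c d : R) :
  \det (mx2 a b c d) = a * d - b * c.
Proof.
rewrite (expand_det_row _ 0) !big_ord_recl big_ord0 /cofactor !det_mx11 !mxE /=.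
by rewrite expr0 mul1r expr1 mulN1r mulrN addr0.
Qed.

Lemma TmxE : Tmx = mx2 1 1 0 1.
Proof. by rewrite [LHS]mx2_eta !mxE. Qed.

Definition Smx : 'M[int]_2 := mx2 0 (-1) 1 0.
Definition Umx : 'M[int]_2 := mx2 0 (-1) 1 1.

Fixpoint word_act (X : Type) (s u : X -> X) (w : bitseq) (x : X) : X :=
  if w is b :: w' then (if b then s else u) (word_act s u w' x) else x.

Lemma word_act_cat (X : Type) (s u : X -> X) w1 w2 x :
  word_act s u (w1 ++ w2) x = word_act s u w1 (word_act s u w2 x).
Proof. by elim: w1 => //= b w1 ->. Qed.

Definition word_mx (w : bitseq) : 'M[int]_2 :=
  word_act (mulmx Smx) (mulmx Umx) w 1%:M.

Lemma word_actM (w : bitseq) (A : 'M[int]_2) :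
  word_act (mulmx Smx) (mulmx Umx) w A = word_mx w *m A.
Proof.
elim: w => [|b w IH] /=; first by rewrite mul1mx.
by rewrite IH /word_mx /=; case: b; rewrite mulmxA.
Qed.

Lemma word_mx_cat w1 w2 : word_mx (w1 ++ w2) = word_mx w1 *m word_mx w2.
Proof. by rewrite /word_mx word_act_cat word_actM. Qed.

(* Equality of the words [w1], [w2] in the group <s, u | s^4 = 1, u^3 = s^2>. *)
Definition word_eq (w1 w2 : bitseq) : Prop :=
  forall (X : Type) (s u : X -> X),
    (forall x, s (s (s (s x))) = x) -> (forall x, u (u (u x)) = s (s x)) ->
    forall x, word_act s u w1 x = word_act s u w2 x.

Lemma word_eq_mx w1 w2 : word_eq w1 w2 -> word_mx w1 = word_mx w2.
Proof.
apply=> A; rewrite /Smx /Umx !mulmxA !mx2_mul //=.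
by rewrite (_ : mx2 _ _ _ _ = 1%:M) ?mul1mx // mx2_1; congr mx2.
Qed.

(** The normal form in the amalgam of Z/4 and Z/6 over Z/2: a central factor [s^2], then [u^a], then
    syllables [s u^2] (for [true]) or [s u] (for [false]), then possibly a last [s]. *)
Definition normal_word (e : bool) (a : nat) (P : bitseq) (b : bool) : bitseq :=
  (if e then [:: true; true] else [::]) ++ nseq a false ++
  flatten [seq if c then [:: true; false; false] else [:: true; false] | c <- P]
  ++ (if b then [:: true] else [::]).

(** Prepending a letter to a normal form yields a normal form again: any [s^2] or [u^3] that appears
    is central, so it moves to the front, where it flips [e]. *)
Lemma word_reduce (w : bitseq) : exists e a P b,
  (a < 3)%N /\ word_eq w (normal_word e a P b).
Proof.
elim: w => [|l w [e [a [P [b [ha IH]]]]]]; first by exists false, 0%N, [::], false.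
suff [e' [a' [P' [b' [ha' H]]]]] : exists e' a' P' b',
    (a' < 3)%N /\ word_eq (l :: normal_word e a P b) (normal_word e' a' P' b').
  by exists e', a', P', b'; split=> // X s u hs hu x; rewrite -H //= IH.
case: l {IH}.
- case: a ha => [|[|[|//]]] _.
  + case: P => [|c P].
      exists (if b then ~~ e else e), 0%N, [::], (~~ b); split=> // X s u hs hu x.
      by case: e b => [] [] /=; rewrite ?hs.
    exists (~~ e), (if c then 2 else 1)%N, P, b; split=> [|X s u hs hu x].
      by case: c.
    by case: e c => [] []; rewrite /= ?hs.
  + by exists e, 0%N, (false :: P), b; split=> // X s u hs hu x; case: e.
  + by exists e, 0%N, (true :: P), b; split=> // X s u hs hu x; case: e.
- have [a2|a2] := leqP 2 a.
    have -> : a = 2 by lia.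
    exists (~~ e), 0%N, P, b; split=> // X s u hs hu x.
    by case: e => /=; rewrite -!hu // !hu hs.
  exists e, a.+1, P, b; split=> // X s u hs hu x.
  by case: e => //=; rewrite -!hu.
Qed.

(** Each syllable is minus an elementary matrix, so prepending it adds one row to the other, up to
    sign. The diagonal stays at least 1 and the off-diagonal sum becomes positive, which keeps
    nonempty products away from scalar matrices. *)
Lemma word_mx_positive (P : bitseq) :
  let A := word_mx (flatten [seq if c then [:: true; false; false]
                                 else [:: true; false] | c <- P]) in
  exists (p q r t : int), (A = mx2 p q r t \/ A = - mx2 p q r t) /\
    [/\ 1 <= p, 0 <= q, 0 <= r & 1 <= t] /\ (P = [::] \/ 1 <= q + r).
Proof.
elim: P => [|c P [p [q [r [t [Hm [[hp hq hr ht] _]]]]]]] /=.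
  by exists 1, 0, 0, 1; rewrite /word_mx /= -mx2_1; do !split=> //; left.
rewrite word_mx_cat; case: c.
  have -> : word_mx [:: true; false; false] = - mx2 1 0 1 1.
    by rewrite /word_mx /= mulmx1 !mx2_mul mx2_opp; congr mx2.
  exists p, q, (p + r), (q + t); split; last by split; [split; lia|right; lia].
  have E : mx2 1 0 1 1 *m mx2 p q r t = mx2 p q (p + r) (q + t).
    by rewrite mx2_mul !mul1r !mul0r !addr0.
  by case: Hm => ->; [right|left]; rewrite -E ?mulmxN !mulNmx ?opprK.
have -> : word_mx [:: true; false] = - mx2 1 1 0 1.
  by rewrite /word_mx /= mulmx1 !mx2_mul mx2_opp; congr mx2.
exists (p + r), (q + t), r, t; split; last by split; [split; lia|right; lia].
have E : mx2 1 1 0 1 *m mx2 p q r t = mx2 (p + r) (q + t) r t.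
  by rewrite mx2_mul !mul1r !mul0r !add0r.
by case: Hm => ->; [right|left]; rewrite -E ?mulmxN !mulNmx ?opprK.
Qed.

(** For nonempty [P] the bound [1 <= q + r] excludes the identity for every choice of sign, [e], [a]
    and [b]; for empty [P] the twelve matrices are explicit. *)
Lemma normal_word_eq1 e a P b : (a < 3)%N ->
  word_mx (normal_word e a P b) = 1%:M -> normal_word e a P b = [::].
Proof.
move=> ha; rewrite /normal_word !word_mx_cat.
have [p [q [r [t [Hm [[hp hq hr ht] hP]]]]]] := word_mx_positive P.
set A := word_mx (flatten _) in Hm *.
have E1 : word_mx (if e then [:: true; true] else [::]) =
    mx2 (if e then -1 else 1) 0 0 (if e then -1 else 1).
  by case: e; rewrite /word_mx /= ?mulmx1 ?mx2_mul -?mx2_1.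
have E2 : word_mx (if b then [:: true] else [::]) =
    if b then Smx else mx2 1 0 0 1.
  by case: b; rewrite /word_mx /= ?mulmx1 -?mx2_1.
have E3 : word_mx (nseq a false) = if a == 0 then mx2 1 0 0 1 else
    if a == 1 then Umx else mx2 (-1) (-1) 1 0.
  by case: a ha => [|[|[|//]]] _; rewrite /word_mx /= ?mulmx1 ?mx2_mul -?mx2_1.
rewrite {}E1 {}E2 {}E3 mx2_1 => H.
suff [-> -> -> ->] : [/\ e = false, a = 0%N, P = [::] & b = false] by [].
case: hP => [P0|hP].
  move: H; rewrite /A P0 /word_mx /= mx2_1 /Smx /Umx; case: e; case: b;
  case: a ha => [|[|[|//]]] _ /=;
  by rewrite !mx2_mul => H; have [] := mx2_inj H.
by move: H; case: Hm => ->; rewrite ?mx2_opp /Smx /Umx; case: e; case: b;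
  case: a ha => [|[|[|//]]] _ /=;
  rewrite !mx2_mul => H; have [*] := mx2_inj H; exfalso; lia.
Qed.

Lemma word_mx_inj w1 w2 : word_mx w1 = word_mx w2 -> word_eq w1 w2.
Proof.
(* [w'] is an inverse of [w2] in the abstract group, where [s] and [u] have inverses [s^3] and
   [s^2 u^2]. It remains to see that [w' ++ w1], a word with trivial matrix, is trivial. *)
have [w' Hl Hr] : exists2 w', word_eq (w' ++ w2) [::] & word_eq (w2 ++ w') [::].
  elim: w2 {w1} => [|l w [w' Hl Hr]]; first by exists [::].
  exists (w' ++ (if l then [:: true; true; true] else [:: true; true; false; false])).
    move=> X s u hs hu x; rewrite -[RHS](Hl X s u hs hu) -catA !word_act_cat.
    by congr (word_act _ _ _ _); case: l; rewrite /= ?hs // hu hs.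
  move=> X s u hs hu x; rewrite /= catA word_act_cat Hr //.
  by case: l; rewrite /= ?hs // -!hu !hu hs.
move=> Hw.
have [e [a [P [b [ha Hn]]]]] := word_reduce (w' ++ w1).
have Hn0 : normal_word e a P b = [::].
  apply: normal_word_eq1 => //.
  rewrite -(word_eq_mx Hn) word_mx_cat Hw -word_mx_cat.
  exact: (word_eq_mx Hl).
move=> X s u hs hu x.
have := Hn X s u hs hu x; rewrite Hn0 word_act_cat /= => E.
by rewrite -{2}E -word_act_cat Hr.
Qed.

Lemma word_mx_T : word_mx [:: true; true; true; false] = Tmx.
Proof. by rewrite TmxE /word_mx /= mulmx1 !mx2_mul; congr mx2. Qed.

Lemma mulz_eq1 (a d : int) : a * d = 1 -> (a = 1 /\ d = 1) \/ (a = -1 /\ d = -1).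
Proof.
move=> Had; have /eqP : (`|a| * `|d| = 1)%N by rewrite -abszM Had.
by rewrite muln_eq1 => /andP[/eqP ha /eqP hd]; nia.
Qed.

(** Euclid's algorithm on the first column: while both entries are nonzero, adding or subtracting
    one row from the other lowers [|a| + |c|]. At the end the matrix is, up to sign, a power of T or
    S times such a power. *)
Lemma word_mx_surj (A : 'M[int]_2) : \det A = 1 -> exists w, word_mx w = A.
Proof.
pose gen B := exists w, word_mx w = B.
have gM B C : gen B -> gen C -> gen (B *m C).
  by move=> [v <-] [w <-]; exists (v ++ w); rewrite word_mx_cat.
have gS : gen (mx2 0 (-1) 1 0) by exists [:: true]; rewrite /word_mx /= mulmx1.
have gU : gen (mx2 0 (-1) 1 1) by exists [:: false]; rewrite /word_mx /= mulmx1.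
have gN B : gen B -> gen (- B).
  move=> gB; have -> : - B = mx2 0 (-1) 1 0 *m mx2 0 (-1) 1 0 *m B.
    rewrite mx2_mul (_ : mx2 _ _ _ _ = - 1%:M) ?mulNmx ?mul1mx // mx2_1 mx2_opp.
    by congr mx2.
  by apply: (gM) => //; apply: gM.
have gT : gen (mx2 1 1 0 1).
  have -> : mx2 1 1 0 1 = - (mx2 0 (-1) 1 0 *m mx2 0 (-1) 1 1) :> 'M[int]_2.
    by rewrite mx2_mul mx2_opp; congr mx2.
  by apply: (gN); apply: gM.
have gL : gen (mx2 1 0 1 1).
  have -> : mx2 1 0 1 1 =
      - (mx2 0 (-1) 1 0 *m mx2 0 (-1) 1 1 *m mx2 0 (-1) 1 1) :> 'M[int]_2.
    by rewrite !mx2_mul mx2_opp; congr mx2.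
  by apply: (gN); apply: (gM) => //; apply: gM.
have gS' : gen (mx2 0 1 (-1) 0).
  by have := gN _ gS; rewrite mx2_opp.
have gT' : gen (mx2 1 (-1) 0 1).
  have -> : mx2 1 (-1) 0 1 = mx2 0 (-1) 1 0 *m mx2 1 0 1 1 *m mx2 0 1 (-1) 0 :> 'M[int]_2.
    by rewrite !mx2_mul; congr mx2.
  by apply: (gM) => //; apply: gM.
have gL' : gen (mx2 1 0 (-1) 1).
  have -> : mx2 1 0 (-1) 1 = mx2 0 (-1) 1 0 *m mx2 1 1 0 1 *m mx2 0 1 (-1) 0 :> 'M[int]_2.
    by rewrite !mx2_mul; congr mx2.
  by apply: (gM) => //; apply: gM.
have gTn k : gen (mx2 1 k%:Z 0 1) /\ gen (mx2 1 (- k%:Z) 0 1).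
  elim: k => [|k [IH1 IH2]].
    by rewrite oppr0 -mx2_1; split; exists [::].
  split.
    have -> : mx2 1 k.+1%:Z 0 1 = mx2 1 1 0 1 *m mx2 1 k%:Z 0 1 :> 'M[int]_2.
      by rewrite mx2_mul; congr mx2; lia.
    exact: gM.
  have -> : mx2 1 (- k.+1%:Z) 0 1 = mx2 1 (-1) 0 1 *m mx2 1 (- k%:Z) 0 1 :> 'M[int]_2.
    by rewrite mx2_mul; congr mx2; lia.
  exact: gM.
have gTz (k : int) : gen (mx2 1 k 0 1).
  by case: (intP k) => [|n|n]; [case: (gTn 0%N)|case: (gTn n.+1)|case: (gTn n.+1)].
rewrite (mx2_eta A) mx2_det.
move: (A 0 0) (A 0 1) (A 1 0) (A 1 1) => a b c d.
have [n] := ubnP (`|a| + `|c|)%N.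
elim: n a b c d => // n IH a b c d Hn Hd.
(* The unprimed matrix is the row operation that shrinks the first column; the primed one is its
   inverse, already known to be generated. *)
have step (p q r t p' q' r' t' : int) : gen (mx2 p' q' r' t') ->
    p * t - q * r = 1 -> (`|(p * a + q * c)%R| + `|(r * a + t * c)%R| < n)%N ->
    mx2 p' q' r' t' *m mx2 p q r t = 1%:M -> gen (mx2 a b c d).
  move=> g1 Hdet Hlt Hinv.
  rewrite -[mx2 a b c d]mul1mx -Hinv -mulmxA mx2_mul; apply: (gM) => //.
  apply: IH => //; rewrite -Hd -[RHS]mul1r -Hdet; ring.
have [c0|c0] := eqVneq c 0.
  have Had : a * d = 1 by rewrite -Hd c0; ring.
  have [[-> ->]|[-> ->]] := mulz_eq1 Had.
    by rewrite c0; exact: gTz.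
  have -> : mx2 (-1) b c (-1) = - mx2 1 (- b) 0 1.
    by rewrite mx2_opp c0; congr mx2; lia.
  by apply: gN; exact: gTz.
have [a0|a0] := eqVneq a 0.
  have Hbc : b * c = - 1 by rewrite -Hd a0; ring.
  have [[-> Ec]|[-> Ec]] : (b = 1 /\ - c = 1) \/ (b = -1 /\ - c = -1).
    by apply: mulz_eq1; rewrite mulrN Hbc.
    have -> : mx2 a 1 c d = mx2 0 (-1) 1 0 *m - mx2 1 (- d) 0 1.
      by rewrite mx2_opp mx2_mul a0; congr mx2; lia.
    by apply: (gM) => //; apply: gN; exact: gTz.
  have -> : mx2 a (-1) c d = mx2 0 (-1) 1 0 *m mx2 1 d 0 1.
    by rewrite mx2_mul a0; congr mx2; lia.
  exact: gM.
have I1 : mx2 1 1 0 1 *m mx2 1 (-1) 0 1 = 1%:M :> 'M[int]_2.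
  by rewrite mx2_mul mx2_1; congr mx2.
have I2 : mx2 1 (-1) 0 1 *m mx2 1 1 0 1 = 1%:M :> 'M[int]_2.
  by rewrite mx2_mul mx2_1; congr mx2.
have I3 : mx2 1 0 1 1 *m mx2 1 0 (-1) 1 = 1%:M :> 'M[int]_2.
  by rewrite mx2_mul mx2_1; congr mx2.
have I4 : mx2 1 0 (-1) 1 *m mx2 1 0 1 1 = 1%:M :> 'M[int]_2.
  by rewrite mx2_mul mx2_1; congr mx2.
have [le_ca|lt_ac] := leqP `|c|%N `|a|%N.
  have [s1|s1] : (0 < a * c) \/ (a * c < 0) by nia.
    by apply: (step _ _ _ _ _ _ _ _ gT _ _ I1) => //; nia.
  by apply: (step _ _ _ _ _ _ _ _ gT' _ _ I2) => //; nia.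
have [s1|s1] : (0 < a * c) \/ (a * c < 0) by nia.
  by apply: (step _ _ _ _ _ _ _ _ gL _ _ I3) => //; nia.
by apply: (step _ _ _ _ _ _ _ _ gL' _ _ I4) => //; nia.
Qed.

Lemma Smx_det : \det Smx == 1. Proof. by rewrite mx2_det. Qed.
Lemma Umx_det : \det Umx == 1. Proof. by rewrite mx2_det. Qed.
Definition SL2Z_S : SL2Z := exist _ Smx Smx_det.
Definition SL2Z_U : SL2Z := exist _ Umx Umx_det.

Lemma SL2Z_word (g : SL2Z) : exists w, word_mx w = proj1_sig g.
Proof. exact/word_mx_surj/eqP/(proj2_sig g). Qed.

(* [SL2Z = <s, u | s^4 = 1, u^3 = s^2>], phrased through actions on a type. *)
Lemma SL2Z_action (X : Type) (s u : X -> X) :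
  (forall x, s (s (s (s x))) = x) -> (forall x, u (u (u x)) = s (s x)) ->
  exists rho : SL2Z -> X -> X,
    [/\ forall x, rho SL2Z_one x = x,
        forall g h x, rho (SL2Z_mul g h) x = rho g (rho h x) &
        forall g w x, word_mx w = proj1_sig g -> rho g x = word_act s u w x].
Proof.
move=> hs hu.
have exw (g : SL2Z) : exists w, word_mx w == proj1_sig g.
  by have [w <-] := SL2Z_word g; exists w.
pose rho g x := word_act s u (xchoose (exw g)) x.
have rhoE g w x : word_mx w = proj1_sig g -> rho g x = word_act s u w x.
  by move=> hw; apply: word_mx_inj => //; rewrite (eqP (xchooseP (exw g))).
exists rho; split=> // [x|g h x]; first by rewrite (rhoE _ [::]).
rewrite (rhoE _ (xchoose (exw g) ++ xchoose (exw h))) ?word_act_cat //.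
by rewrite word_mx_cat (eqP (xchooseP (exw g))) (eqP (xchooseP (exw h))).
Qed.

(** An action is determined by its generators. In the induction the tail of the word must itself be
    a group element; its determinant is 1 because those of S and U are. *)
Lemma action_word (X : Type) (rho : SL2Z -> X -> X) :
  (forall x, rho SL2Z_one x = x) ->
  (forall g h x, rho (SL2Z_mul g h) x = rho g (rho h x)) ->
  forall g w x, word_mx w = proj1_sig g ->
    rho g x = word_act (rho SL2Z_S) (rho SL2Z_U) w x.
Proof.
move=> rho1 rhoM g w x; elim: w g x => [|b w IH] g x hw.
  by rewrite -[RHS]rho1; congr rho; apply: val_inj; rewrite /= -hw.
have [h hh] : exists h : SL2Z, proj1_sig h = word_mx w.
  have dw : \det (word_mx w) == 1.
    have /eqP := proj2_sig g; rewrite -hw /word_mx /= -/(word_mx w).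
    by case: b {hw}; rewrite det_mulmx ?(eqP Smx_det) ?(eqP Umx_det) mul1r => ->.
  by exists (exist (fun A => \det A == 1) (word_mx w) dw).
rewrite /= -(IH h) //.
have -> : g = SL2Z_mul (if b then SL2Z_S else SL2Z_U) h.
  by apply: val_inj; rewrite /= -hw /word_mx /= hh; case: b {hw}.
by rewrite rhoM; case: b {hw}.
Qed.

(** * Linear identities *)

(* A reflexive decision procedure for linear identities in a module: both
   sides are compared coefficient by coefficient. *)
Inductive lexpr (K : Type) : Type :=
| LAtom of nat | LZero | LAdd of lexpr K & lexpr K | LOpp of lexpr K
| LScale of K & lexpr K.
Arguments LAtom {K}. Arguments LZero {K}.

Section LinearExpressions.
Variables (K : pzRingType) (M : lmodType K).

Fixpoint leval (env : seq M) (e : lexpr K) : M :=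
  match e with
  | LAtom n => env`_n
  | LZero => 0
  | LAdd a b => leval env a + leval env b
  | LOpp a => - leval env a
  | LScale c a => c *: leval env a
  end.

Fixpoint lcoef (e : lexpr K) (n : nat) : K :=
  match e with
  | LAtom m => if eqn m n then 1 else 0
  | LZero => 0
  | LAdd a b => lcoef a n + lcoef b n
  | LOpp a => - lcoef a n
  | LScale c a => c * lcoef a n
  end.

Lemma levalE env e : leval env e = \sum_(i < size env) lcoef e i *: env`_i.
Proof.
elim: e => [n||a IHa b IHb|a IHa|c a IHa] /=.
- have [hn|hn] := ltnP n (size env); last first.
    rewrite nth_default // big1 // => i _.
    case: eqnP => [E|_]; last by rewrite scale0r.
    by have := ltn_ord i; rewrite -E ltnNge hn.
  rewrite (bigD1 (Ordinal hn)) //=; case: eqnP => // _; rewrite scale1r.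
  rewrite big1 ?addr0 // => i ni; case: eqnP => [E|_]; last by rewrite scale0r.
  by case/eqP: ni; apply: val_inj.
- by rewrite big1 // => i _; rewrite scale0r.
- by rewrite IHa IHb -big_split; apply: eq_bigr => i _; rewrite scalerDl.
- by rewrite IHa -sumrN; apply: eq_bigr => i _; rewrite scaleNr.
- by rewrite IHa scaler_sumr; apply: eq_bigr => i _; rewrite scalerA.
Qed.

Fixpoint lcoef_eq (n : nat) (a b : lexpr K) : Prop :=
  if n is n'.+1 then lcoef a n' = lcoef b n' /\ lcoef_eq n' a b else True.

Lemma leval_eq env a b : lcoef_eq (size env) a b -> leval env a = leval env b.
Proof.
rewrite !levalE => H; apply: eq_bigr => -[i hi] _ /=; congr (_ *: _).
elim: (size env) hi H => //= n IH; rewrite ltnS leq_eqVlt => /orP[/eqP->[]//|hi [_]].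
exact: IH.
Qed.

End LinearExpressions.

Ltac lmod_index x env :=
  lazymatch env with
  | x :: _ => constr:(0%N)
  | _ :: ?e => let n := lmod_index x e in constr:(n.+1)
  end.

Ltac lmod_env e env :=
  lazymatch e with
  | 0 => env
  | ?a + ?b => let env1 := lmod_env a env in lmod_env b env1
  | - ?a => lmod_env a env
  | ?c *: ?a => lmod_env a env
  | _ => match env with
         | _ => let n := lmod_index e env in env
         | _ => constr:(e :: env)
         end
  end.

Ltac lmod_reify K e env :=
  lazymatch e with
  | 0 => constr:(@LZero K)
  | ?a + ?b => let a' := lmod_reify K a env in
               let b' := lmod_reify K b env in constr:(@LAdd K a' b')
  | - ?a => let a' := lmod_reify K a env in constr:(@LOpp K a')
  | ?c *: ?a => let a' := lmod_reify K a env in constr:(@LScale K c a')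
  | _ => let n := lmod_index e env in constr:(@LAtom K n)
  end.

Ltac lmod_start :=
  lazymatch goal with
  | |- @eq ?M ?a ?b =>
    let env := lmod_env a (@nil M) in
    let env := lmod_env b env in
    let a' := lmod_reify CC a env in
    let b' := lmod_reify CC b env in
    apply: (@leval_eq _ _ env a' b');
    cbn [lcoef_eq lcoef size eqn]
  end.
Tactic Notation "lmod" := lmod_start; repeat split; ring.
Tactic Notation "lmod" constr(h) := lmod_start; repeat split; ring: h.

(** * Modules filtered by copies of V *)

Definition linear_map (M M' : lmodType CC) (f : M -> M') : Prop :=
  forall (a : CC) x y, f (a *: x + y) = a *: f x + f y.

Section LinearMap.
Variables (M M' : lmodType CC) (f : M -> M') (f_lin : linear_map f).

Lemma linear_map0 : f 0 = 0.
Proof.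
have := f_lin 1 0 0; rewrite !scale1r addr0 => /eqP.
by rewrite -subr_eq subrr => /eqP <-.
Qed.
Lemma linear_mapD x y : f (x + y) = f x + f y.
Proof. by have := f_lin 1 x y; rewrite !scale1r. Qed.
Lemma linear_mapZ a x : f (a *: x) = a *: f x.
Proof. by have := f_lin a x 0; rewrite linear_map0 !addr0. Qed.
Lemma linear_mapN x : f (- x) = - f x.
Proof. by rewrite -scaleN1r linear_mapZ scaleN1r. Qed.
End LinearMap.

Section Subspace.
Variables (M : lmodType CC) (W : M -> Prop) (W_sub : subspace W).

Lemma subspace0 : W 0. Proof. by case: W_sub. Qed.
Lemma subspaceZD a x y : W x -> W y -> W (a *: x + y).
Proof. by case: W_sub => _; apply. Qed.
Lemma subspaceD x y : W x -> W y -> W (x + y).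
Proof. by move=> hx hy; rewrite -[x]scale1r; apply: subspaceZD. Qed.
Lemma subspaceZ a x : W x -> W (a *: x).
Proof. by move=> hx; rewrite -[_ *: _]addr0; apply: subspaceZD => //; apply: subspace0. Qed.
Lemma subspaceN x : W x -> W (- x).
Proof. by move=> hx; rewrite -scaleN1r; apply: subspaceZ. Qed.
End Subspace.

(* [F] is a filtration, stable under [s] and [u], whose successive quotients
   carry the action of [Smx] and [Umx] on column vectors [(g1 x, g2 x)]. *)
Record su_filtration (M : lmodType CC) (s u : M -> M) (F : nat -> M -> Prop) := {
  suf_sub : forall n, subspace (F n);
  suf_s : forall n x, F n x -> F n (s x);
  suf_u : forall n x, F n x -> F n (u x);
  suf_0 : forall x, F 0%N x -> x = 0;
  suf_S : forall n x, F n x -> F n.+1 x;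
  suf_exh : forall x, exists n, F n x;
  suf_quo : forall n, exists g1 g2 : M -> CC,
    [/\ forall a x y, F n.+1 x -> F n.+1 y ->
          g1 (a *: x + y) = a * g1 x + g1 y /\ g2 (a *: x + y) = a * g2 x + g2 y,
        forall x, F n.+1 x -> g1 (s x) = - g2 x /\ g2 (s x) = g1 x,
        forall x, F n.+1 x -> g1 (u x) = - g2 x /\ g2 (u x) = g1 x + g2 x,
        forall a b, exists2 x, F n.+1 x & g1 x = a /\ g2 x = b &
        forall x, F n.+1 x -> (g1 x = 0 /\ g2 x = 0 <-> F n x)] }.

(** Characteristic zero: [(k + 1) x = 0] forces [x = 0]. It serves with [k = 1] for [s] and [k = 2]
    for [u]. *)
Lemma eq_oppr_self (M : lmodType CC) (x : M) (k : nat) : x = - (k%:R *: x) -> x = 0.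
Proof.
move=> /eqP; rewrite -subr_eq0 opprK -{1}[x]scale1r -scalerDl -mulrS scaler_eq0.
by rewrite pnatr_eq0 => /orP[//|/eqP].
Qed.

(** * Relations forced by the filtration, and the central operator z *)

Section Filtered.
Variables (M : lmodType CC) (s u : M -> M) (F : nat -> M -> Prop).
Hypotheses (s_lin : linear_map s) (u_lin : linear_map u).
Hypothesis (HF : su_filtration s u F).
Hypotheses (s4 : forall x, s (s (s (s x))) = x)
           (u3 : forall x, u (u (u x)) = s (s x)).

Let sL := (linear_mapD s_lin, linear_mapZ s_lin, linear_mapN s_lin).
Let uL := (linear_mapD u_lin, linear_mapZ u_lin, linear_mapN u_lin).

Lemma suf_ind (P : M -> Prop) : P 0 ->
  (forall n, (forall x, F n x -> P x) -> forall x, F n.+1 x -> P x) ->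
  forall x, P x.
Proof.
move=> P0 PS x; have [n] := suf_exh HF x; elim: n x => [x /(suf_0 HF)->//|n IH].
exact: PS.
Qed.

(** Since [S^2 = -1] on V, the vector [y = s^2 x + x] lies one step lower, where [s^2 y = - y] by
    induction; but [s^4 = 1] gives [s^2 y = y], so [2 y = 0]. *)
Lemma su_s2 x : s (s x) = - x.
Proof.
apply: (suf_ind (P := fun x => s (s x) = - x)) x.
  by rewrite !(linear_map0 s_lin) oppr0.
move=> n IH x hx; have [g1 [g2 [glin gs gu _ gk]]] := suf_quo HF n.
have hsx := suf_s HF hx; have hssx := suf_s HF hsx.
have hy : F n (s (s x) + x).
  rewrite -[s (s x)]scale1r; apply/gk.
    by apply: subspaceZD => //; apply: suf_sub HF _.
  have [-> ->] := glin 1 _ _ hssx hx.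
  have [-> ->] := gs _ hsx; have [-> ->] := gs _ hx; split; ring.
have := IH _ hy; rewrite !sL s4 => E.
have /eq_oppr_self : s (s x) + x = - (1%:R *: (s (s x) + x)).
  by rewrite scale1r -E addrC.
by move/eqP; rewrite addr_eq0 => /eqP.
Qed.

(** The vector [y = u^2 x - u x + x] lies one step lower, so [u^2 y = u y - y] by induction. As
    [(u + 1)(u^2 - u + 1) = u^3 + 1 = 0], also [u y = - y]; together [3 y = 0]. *)
Lemma su_u2 x : u (u x) = u x - x.
Proof.
apply: (suf_ind (P := fun x => u (u x) = u x - x)) x.
  by rewrite !(linear_map0 u_lin) subr0.
move=> n IH x hx; have [g1 [g2 [glin gs gu _ gk]]] := suf_quo HF n.
have hux := suf_u HF hx; have huux := suf_u HF hux.
have hw : F n.+1 ((-1) *: u x + x) by apply: subspaceZD => //; apply: suf_sub HF _.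
pose y := u (u x) - u x + x.
have hy : F n y.
  have -> : y = 1 *: u (u x) + ((-1) *: u x + x) by rewrite /y; lmod.
  apply/gk; first by apply: subspaceZD => //; apply: suf_sub HF _.
  have [-> ->] := glin 1 _ _ huux hw; have [-> ->] := glin (-1) _ _ hux hx.
  have [-> ->] := gu _ hux; have [-> ->] := gu _ hx; split; ring.
have uy : u y = - y by rewrite /y !uL !u3 su_s2; lmod.
have : y = - (2%:R *: y).
  by have := IH _ hy; rewrite !(uy, uL) opprK => {1}->; lmod.
move/eq_oppr_self => y0; apply/eqP; rewrite -subr_eq0 -y0; apply/eqP.
by rewrite /y; lmod.
Qed.

(* [z = t + t^-1 - 2], where [t = - s u] is the action of T. *)
Definition su_z (x : M) : M := s x - u (s x) - s (u x) - (x + x).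

Lemma su_z_lin : linear_map su_z.
Proof. by move=> a x y; rewrite /su_z !sL !uL !sL; lmod. Qed.
Let zL := (linear_mapD su_z_lin, linear_mapZ su_z_lin, linear_mapN su_z_lin).

Lemma su_zs x : su_z (s x) = s (su_z x).
Proof. by rewrite /su_z !(sL, uL, su_s2, su_u2); lmod. Qed.

Lemma su_zu x : su_z (u x) = u (su_z x).
Proof. by rewrite /su_z !(sL, uL, su_s2, su_u2); lmod. Qed.

Lemma su_su x : s (u x) = s x - u (s x) - su_z x - (x + x).
Proof. by rewrite /su_z; lmod. Qed.

(** On V, Cayley-Hamilton for T, of trace 2 and determinant 1, gives [T + T^-1 = 2], so z vanishes
    on each quotient. *)
Lemma suf_z n x : F n.+1 x -> F n (su_z x).
Proof.
move=> hx; have [g1 [g2 [glin gs gu _ gk]]] := suf_quo HF n.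
have Fsub := suf_sub HF n.+1.
have hsx := suf_s HF hx; have husx := suf_u HF hsx.
have hux := suf_u HF hx; have hsux := suf_s HF hux.
have h0 := subspaceZD Fsub (-3%:R) hx hx.
have h1 := subspaceZD Fsub (-1) hsux h0; have h2 := subspaceZD Fsub (-1) husx h1.
(* The sum is nested in the shape [a *: x + y], in which [g1] and [g2] are known to be linear;
   [-3 x + x] stands for [- (x + x)]. *)
have -> : su_z x =
    1 *: s x + (-1 *: u (s x) + (-1 *: s (u x) + (-3%:R *: x + x))).
  by rewrite /su_z; lmod.
apply/gk; first exact: subspaceZD.
have [-> ->] := glin 1 _ _ hsx h2; have [-> ->] := glin (-1) _ _ husx h1.
have [-> ->] := glin (-1) _ _ hsux h0; have [-> ->] := glin (-3%:R) _ _ hx hx.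
have [-> ->] := gu _ hsx; have [-> ->] := gs _ hux.
by have [-> ->] := gu _ hx; have [-> ->] := gs _ hx; split; ring.
Qed.

(** As [z = T^-1 (T - 1)^2], a vector x killed by z has [(T - 1) x] fixed by [T = - s u]. *)
Lemma su_z_eq0 x : su_z x = 0 ->
  s (u (- s (u x) - x)) = - (- s (u x) - x).
Proof.
move=> zx; have := congr1 (fun y => s (u y)) zx.
rewrite /su_z !(sL, uL, su_s2, su_u2, linear_map0 u_lin, linear_map0 s_lin) => E.
apply/eqP; rewrite -subr_eq0 -E; apply/eqP; lmod.
Qed.

(** Two applications of [T - 1] amount to [T z], which lowers the filtration by one step. *)
Lemma su_unipotent x : exists k, iter k (fun y => - s (u y) - y) x = 0.
Proof.
have [n] := suf_exh HF x; elim: n x => [x /(suf_0 HF)->|n IH x hx].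
  by exists 0%N.
have [k hk] := IH _ (subspaceN (suf_sub HF n) (suf_s HF (suf_u HF (suf_z hx)))).
exists k.+2; rewrite 2!iterSr -[RHS]hk; congr iter.
by rewrite /su_z !(sL, uL, su_s2, su_u2); lmod.
Qed.

(** * The i-eigenspace L of S as a module over z *)

Hypothesis ker1 : forall x y, s (u x) = - x -> s (u y) = - y ->
  exists a b : CC, (a, b) != (0, 0) /\ a *: x + b *: y = 0.

Variables (i : CC) (i2 : i ^+ 2 = -1).

Definition suL (x : M) : Prop := s x = i *: x.

Lemma i_neq0 : i != 0.
Proof. by apply: contra_eq_neq i2 => ->; rewrite expr0n eq_sym oppr_eq0 oner_eq0. Qed.

Lemma suL_sub : subspace suL.
Proof.
split=> [|a x y hx hy]; rewrite /suL ?(linear_map0 s_lin) ?scaler0 // !sL hx hy; lmod.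
Qed.

Lemma suL_z x : suL x -> suL (su_z x).
Proof. by rewrite /suL -su_zs => ->; rewrite zL. Qed.

(** On the kernel of z, [T - 1] takes values in the line of T-fixed vectors, and it is injective on
    L: if [T w = w] and [s w = i w] then [u w = i w], whereas i is not a root of [X^2 - X + 1]. *)
Lemma suL_ker x y : suL x -> suL y -> su_z x = 0 -> su_z y = 0 ->
  exists a b : CC, (a, b) != (0, 0) /\ a *: x + b *: y = 0.
Proof.
move=> Lx Ly /su_z_eq0 kx /su_z_eq0 ky.
have [a [b [ab E]]] := ker1 kx ky.
exists a, b; split=> //; set w := a *: x + b *: y.
have Lw : suL w by apply: (subspaceZD suL_sub) => //; apply: (subspaceZ suL_sub).
have uw : s (u w) = - w.
  apply/eqP; rewrite -addr_eq0 -oppr_eq0 -E /w; apply/eqP.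
  by rewrite !(sL, uL); lmod.
have uw' : u w = i *: w.
  by have := congr1 s uw; rewrite su_s2 sL Lw => /oppr_inj.
have := su_u2 w; rewrite uw' uL uw' => {}E.
suff : i *: w = 0 by move/eqP; rewrite scaler_eq0 (negPf i_neq0) => /eqP.
have -> : i *: w = i *: w - w - i *: (i *: w) by lmod i2.
by rewrite -E subrr.
Qed.

Lemma suL_quo n : exists e, [/\ suL e, F n.+1 e, ~ F n e &
  forall y, suL y -> F n.+1 y -> exists c : CC, F n (y - c *: e)].
Proof.
have [g1 [g2 [glin gs gu gsurj gk]]] := suf_quo HF n.
have Fsub := suf_sub HF n.+1.
(* [(1, - i)] is the i-eigenvector of S on V; applying [s + i] to a lift x moves it into L and
   multiplies its image by [2 i]. *)
have [x hx [gx1 gx2]] := gsurj 1 (- i).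
have hsx := suf_s HF hx.
pose e := i *: x + s x.
have he : F n.+1 e by apply: subspaceZD.
have Le : suL e by rewrite /suL /e !(sL, su_s2); lmod i2.
have ge1 : g1 e = i + i.
  have [-> _] := glin i _ _ hx hsx; have [-> _] := gs _ hx.
  by rewrite gx1 gx2; ring.
have ge0 : g1 e != 0.
  by rewrite ge1 -mulr2n mulrn_eq0 negb_or /= i_neq0.
exists e; split=> // [/(gk _ he)[g10 _]|y Ly hy]; first by rewrite g10 eqxx in ge0.
exists (g1 y / g1 e); rewrite -scaleNr addrC; set c := - _.
apply/gk; first exact: subspaceZD.
(* On L, [- g2 w = g1 (s w) = i g1 w], so [g1] alone decides membership in [F n]. *)
suff g10 : g1 (c *: e + y) = 0.
  split=> //; have hw := subspaceZD Fsub c he hy.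
  have Lw : suL (c *: e + y) by apply: (subspaceZD suL_sub).
  have [gsw _] := gs _ hw; rewrite Lw in gsw.
  have /eqP := gsw.
  have hiw : F n.+1 (i *: (c *: e + y)) by apply: subspaceZ.
  have := glin (i - 1) _ _ hw hw.
  have -> : (i - 1) *: (c *: e + y) + (c *: e + y) = i *: (c *: e + y) by lmod.
  by rewrite g10 mulr0 addr0 => -[-> _]; rewrite eq_sym oppr_eq0 => /eqP.
by have [-> _] := glin c _ _ he hy; rewrite /c mulNr divfK ?addNr.
Qed.

(** In effect a dimension count: [F n] meets L in dimension n, and z maps level [n + 1] of L to
    level n with a kernel of dimension one. *)
Lemma suL_z_surj y : suL y -> exists2 x, suL x & su_z x = y.
Proof.
have [n] := suf_exh HF y => hy Ly.
suff [x [Lx _ <-]] : exists x, [/\ suL x, F n.+1 x & su_z x = y] by exists x.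
elim: n y hy Ly => [y /(suf_0 HF)-> _|n IH y hy Ly].
  by exists 0; rewrite (linear_map0 su_z_lin); split=> //;
    [apply: subspace0 suL_sub|apply: subspace0 (suf_sub HF _)].
have [e [Le he ne hec]] := suL_quo n.
have [f [Lf hf nf hfc]] := suL_quo n.+1.
have [e0 [Le0 he0 ne0 he0c]] := suL_quo 0.
have Fsub := suf_sub HF.
have [c hc] := hec _ (suL_z Lf) (suf_z hf).
have [d hd] := hec _ Ly hy.
have Lsub a v w : suL v -> suL w -> suL (v - a *: w).
  by move=> hv hw; rewrite -scaleNr addrC; apply: subspaceZD suL_sub _ _ _ hw hv.
have [v [Lv hv zv]] := IH _ hc (Lsub _ _ _ (suL_z Lf) Le).
have [w [Lw hw zw]] := IH _ hd (Lsub _ _ _ Ly Le).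
(* Modulo lower terms, which the induction lifts, [z f] is [c e] and y is [d e]. If c is nonzero,
   [d / c] solves the equation. If [c = 0], then [f - v] is in the kernel of z, hence a multiple of
   [e0], which puts f in [F n.+1]. *)
have [c0|c0] := eqVneq c 0; last first.
  exists (w + (d / c) *: (f - v)); split.
  - apply: subspaceD suL_sub _ _ Lw _; apply: subspaceZ suL_sub _ _ _.
    by rewrite -[v]scale1r; apply: Lsub.
  - apply: subspaceD (Fsub _) _ _ (suf_S HF hw) _; apply: subspaceZ (Fsub _) _ _ _.
    by apply: subspaceD (Fsub _) _ _ hf _; apply: subspaceN (Fsub _) _ (suf_S HF hv).
  - rewrite !zL zw zv.
    have -> : su_z f - (su_z f - c *: e) = c *: e by lmod.
    by rewrite scalerA divfK // subrK.
exfalso; rewrite c0 scale0r subr0 in zv.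
have z1 : su_z (1 *: f + (-1) *: v) = 0 by rewrite !zL zv; lmod.
have L1 : suL (1 *: f + (-1) *: v).
  by apply: subspaceD suL_sub _ _ _ _; apply: subspaceZ suL_sub _ _ _.
have z0 : su_z e0 = 0 by apply: (suf_0 HF); apply: suf_z.
have [a [b [ab E]]] := suL_ker L1 Le0 z1 z0.
have F0 k : F 1%N e0 -> F k.+1 e0 by elim: k => // k IHk /IHk /(suf_S HF).
have [a0|a0] := eqVneq a 0.
  move: E ab; rewrite a0 scale0r add0r => /eqP; rewrite scaler_eq0.
  case/orP=> [/eqP->|/eqP e00]; first by rewrite eqxx.
  by case: ne0; rewrite e00; apply: subspace0 (Fsub _).
apply: nf; have -> : f = v + (- b / a) *: e0.
  have aV : a * a^-1 = 1 by rewrite divff.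
  apply/eqP; rewrite -subr_eq0 -[X in _ == X](scaler0 _ a^-1) -E; apply/eqP.
  by lmod aV.
apply: subspaceD (Fsub _) _ _ hv _; apply: subspaceZ (Fsub _) _ _ _; exact: F0.
Qed.

(** An infinite Jordan chain for z: start from a generator of its kernel on L and iterate a chosen
    section of z. *)
Lemma suL_chain : exists e : nat -> M,
  [/\ forall n, suL (e n), su_z (e 0%N) = 0, forall n, su_z (e n.+1) = e n,
      e 0%N != 0 & forall x, suL x -> su_z x = 0 -> exists c : CC, x = c *: e 0%N].
Proof.
have [e0 [Le0 he0 ne0 _]] := suL_quo 0.
have z0 : su_z e0 = 0 by apply: (suf_0 HF); apply: suf_z.
have e0n0 : e0 != 0 by apply/eqP => E; case: ne0; rewrite E; apply: subspace0 (suf_sub HF _).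
have [f hf] : {f & forall x, suL x -> suL (f x) /\ su_z (f x) = x}.
  apply: (@choice _ _ (fun x y => suL x -> suL y /\ su_z y = x)) => x.
  have [Lx|nLx] := pselect (suL x); last by exists 0.
  by have [y] := suL_z_surj Lx; exists y.
have Le n : suL (iter n f e0) by elim: n => //= n /hf[].
exists (fun n => iter n f e0); split=> // [n|x Lx zx].
  by have [] := hf _ (Le n).
have [a [b [ab E]]] := suL_ker Lx Le0 zx z0.
have [a0|a0] := eqVneq a 0.
  move: E ab; rewrite a0 scale0r add0r => /eqP.
  by rewrite scaler_eq0 (negPf e0n0) orbF => /eqP->; rewrite eqxx.
exists (- b / a); have aV : a * a^-1 = 1 by rewrite divff.
apply/eqP; rewrite -subr_eq0 -[X in _ == X](scaler0 _ a^-1) -E /=; apply/eqP.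
by lmod aV.
Qed.

(** * Polynomial coordinates on L and on the whole module *)

Section Chain.
Variable e : nat -> M.
Hypotheses (Le : forall n, suL (e n)) (ze0 : su_z (e 0%N) = 0)
  (zeS : forall n, su_z (e n.+1) = e n) (e0_neq0 : e 0%N != 0)
  (ker_e0 : forall x, suL x -> su_z x = 0 -> exists c : CC, x = c *: e 0%N).

Definition su_phi (p : {poly CC}) : M := \sum_(k < size p) p`_k *: e k.

Lemma su_phiE n (p : {poly CC}) : (size p <= n)%N -> su_phi p = \sum_(k < n) p`_k *: e k.
Proof.
move=> hn; rewrite /su_phi (big_ord_widen n (fun k => p`_k *: e k)) // big_mkcond.
apply: eq_bigr => k _; case: ltnP => // hk.
by rewrite nth_default ?scale0r.
Qed.

Lemma su_phi_lin a p q : su_phi (a *: p + q) = a *: su_phi p + su_phi q.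
Proof.
pose n := maxn (size p) (size q).
rewrite !(@su_phiE n) ?leq_maxl ?leq_maxr //; last first.
  apply: leq_trans (size_polyD _ _) _; rewrite geq_max leq_maxr andbT.
  exact: leq_trans (size_scale_leq _ _) (leq_maxl _ _).
rewrite scaler_sumr -big_split; apply: eq_bigr => k _ /=.
by rewrite coefD coefZ; lmod.
Qed.

Lemma su_phi_drop p : su_phi (drop_poly 1 p) = su_z (su_phi p).
Proof.
rewrite (@su_phiE (size p).+1 p) // big_ord_recl.
rewrite (@su_phiE (size p)) ?size_drop_poly ?leq_subr //.
rewrite zL zL ze0 scaler0 add0r.
rewrite (big_morph su_z (linear_mapD su_z_lin) (linear_map0 su_z_lin)); apply: eq_bigr => k _.
by rewrite zL zeS coef_drop_poly addn1.
Qed.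

Lemma su_phiC c : su_phi c%:P = c *: e 0%N.
Proof.
by rewrite (@su_phiE 1) ?size_polyC_leq1 // big_ord_recl big_ord0 addr0 coefC.
Qed.

Lemma suL_phi p : suL (su_phi p).
Proof.
rewrite /su_phi; elim/big_ind: _ => [|x y|k _]; first exact: subspace0 suL_sub.
  exact: subspaceD suL_sub _ _.
by apply: subspaceZ suL_sub _ _ _.
Qed.

(** Applying z shifts p down, so by induction on the size p is constant, and [e 0] is nonzero. *)
Lemma su_phi_eq0 p : su_phi p = 0 -> p = 0.
Proof.
have [n] := ubnP (size p); elim: n p => // n IH p hp p0.
have sd : (size (drop_poly 1 p) <= (size p).-1)%N by rewrite size_drop_poly subn1.
have [sp|sp] := posnP (size p); first by apply/eqP; rewrite -size_poly_eq0 sp.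
have : drop_poly 1 p = 0.
  apply: IH; last by rewrite su_phi_drop p0 (linear_map0 su_z_lin).
  by apply: leq_ltn_trans sd _; rewrite prednK.
move=> d0; have pE : p = (p`_0)%:P.
  apply/polyP => -[|k]; rewrite coefC //=.
  by have := congr1 (fun q : {poly CC} => q`_k) d0; rewrite coef_drop_poly addn1 coef0.
move: p0; rewrite pE su_phiC => /eqP; rewrite scaler_eq0 (negPf e0_neq0) orbF.
by move=> /eqP->.
Qed.

(** By induction [z x] has a preimage q; multiplying by ['X] undoes the shift, and the remaining
    error is in the kernel of z, the line of [e 0]. *)
Lemma su_phi_surj x : suL x -> exists p, su_phi p = x.
Proof.
have [n] := suf_exh HF x; elim: n x => [x /(suf_0 HF)-> _|n IH x hx Lx].
  by exists 0; rewrite /su_phi size_poly0 big_ord0.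
have [q hq] := IH _ (suf_z hx) (suL_z Lx).
have dq : drop_poly 1 (q * 'X) = q.
  by apply/polyP => k; rewrite coef_drop_poly coefMX addn1.
have [c hc] : exists c : CC, x - su_phi (q * 'X) = c *: e 0%N.
  apply: ker_e0; last by rewrite !zL -su_phi_drop dq hq subrr.
  by apply: subspaceD suL_sub _ _ _ _ => //; apply: subspaceN suL_sub _ _; apply: suL_phi.
exists (c *: 1 + q * 'X); rewrite su_phi_lin -polyC1 su_phiC scale1r -hc.
exact: subrK.
Qed.

Let Im (x : M) : Prop := exists l1 l2, [/\ suL l1, suL l2 & x = l1 + u l2].

Lemma su_Im_sub : subspace Im.
Proof.
split.
  exists 0, 0; split; try exact: subspace0 suL_sub.
  by rewrite (linear_map0 u_lin) addr0.
move=> a x y [l1 [l2 [h1 h2 ->]]] [m1 [m2 [h3 h4 ->]]].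
exists (a *: l1 + m1), (a *: l2 + m2); split; try exact: subspaceZD suL_sub _ _ _ _ _.
by rewrite !uL; lmod.
Qed.

(* Modulo [L + u L], [x] is [- (z^2 + 4 z) x], which lies lower in the filtration. *)
Lemma su_Im_anti x : s x = - i *: x -> Im x.
Proof.
have [n] := suf_exh HF x; elim: n x => [x /(suf_0 HF)-> _|n IH x hx sx].
  exact: subspace0 su_Im_sub.
have szx : s (su_z x) = - i *: su_z x by rewrite -su_zs sx zL.
have szzx : s (su_z (su_z x)) = - i *: su_z (su_z x) by rewrite -su_zs szx zL.
have Izx : Im (su_z x) by apply: IH => //; apply: suf_z.
have Izzx : Im (su_z (su_z x)).
  by apply: IH => //; apply: suf_z; apply: (suf_S HF); apply: suf_z.
(* [s + i] maps into L because [(s - i)(s + i) = s^2 + 1 = 0]. *)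
pose l := s (u x) + i *: u x.
have Ll : suL l by rewrite /suL /l !(sL, su_s2); lmod i2.
have suxE : s (u x) = - i *: x + i *: u x - su_z x - (x + x).
  by rewrite su_su sx uL; lmod.
have E : su_z (su_z x) + 4%:R *: su_z x + x =
    ((i - 2%:R) *: l - su_z l) + u ((-2%:R * i) *: l).
  rewrite /l suxE !(zL, uL, su_zu, su_u2); lmod i2.
have -> : x = ((-1) *: su_z (su_z x) + (- 4%:R) *: su_z x) +
    (((i - 2%:R) *: l - su_z l) + u ((-2%:R * i) *: l)).
  by rewrite -E; lmod.
apply: (subspaceD su_Im_sub).
  by apply: (subspaceZD su_Im_sub) => //; apply: (subspaceZ su_Im_sub).
exists ((i - 2%:R) *: l - su_z l), ((-2%:R * i) *: l); split=> //.
  apply: (subspaceD suL_sub); first exact: (subspaceZ suL_sub).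
  by apply: (subspaceN suL_sub); apply: suL_z.
exact: (subspaceZ suL_sub).
Qed.

(** Up to the factor [2 i], x is the sum of its components in the two eigenspaces of [s]: the first
    is in L, the second is covered by [su_Im_anti]. *)
Lemma su_Im_all x : Im x.
Proof.
have I1 : Im (s x + i *: x).
  exists (s x + i *: x), 0; rewrite (linear_map0 u_lin) addr0; split=> //.
    by rewrite /suL !(sL, su_s2); lmod i2.
  exact: subspace0 suL_sub.
have I2 : Im (i *: x - s x).
  by apply: su_Im_anti; rewrite !(sL, su_s2); lmod i2.
have i2n : (2%:R * i) * (2%:R * i)^-1 = 1.
  by rewrite divff // mulf_neq0 ?i_neq0 // pnatr_eq0.
have -> : x = (2%:R * i)^-1 *: (1 *: (s x + i *: x) + (i *: x - s x)) by lmod i2n.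
by apply: (subspaceZ su_Im_sub); apply: (subspaceZD su_Im_sub).
Qed.

(** The relation makes z act on the span of [l1] and [l2] by a matrix of trace -4 and determinant 1.
    So [z^2 + 4 z + 1] kills [l2], and [l2 = - (z^2 + 4 z) l2] descends through the filtration to
    0. *)
Lemma su_Im_inj l1 l2 : suL l1 -> suL l2 -> l1 + u l2 = 0 -> l1 = 0 /\ l2 = 0.
Proof.
move=> L1 L2 E.
have ul2 : u l2 = - l1 by apply/eqP; rewrite -addr_eq0 addrC E.
have E1 : su_z l2 = (i - 2%:R) *: l2 + (2%:R * i) *: l1.
  have := su_su l2; rewrite L2 uL ul2 !sL L1 => H.
  have -> : su_z l2 = i *: l2 - i *: - l1 - (- (i *: l1)) - (l2 + l2) by rewrite H; lmod.
  by lmod.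
have ul1 : u l1 = l1 + l2.
  by have := su_u2 l2; rewrite ul2 uL => H; rewrite -[u l1]opprK H; lmod.
have E2 : su_z l1 = - (2%:R + i) *: l1 - (2%:R * i) *: l2.
  have := su_zu l2; rewrite ul2 E1 !(uL, zL) ul1 ul2 => H.
  by rewrite -[su_z l1]opprK H; lmod.
have E3 : l2 = - (su_z (su_z l2) + 4%:R *: su_z l2).
  by rewrite E1 !zL E1 E2; lmod i2.
suff H : l2 = 0 by split=> //; apply: oppr_inj; rewrite -ul2 H (linear_map0 u_lin) oppr0.
have [n] := suf_exh HF l2; elim: n => [/(suf_0 HF)//|n IH hn].
apply: IH; rewrite E3; apply: (subspaceN (suf_sub HF n)).
apply: (subspaceD (suf_sub HF n)); last by apply: (subspaceZ (suf_sub HF n)); apply: suf_z.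
by apply: suf_z; apply: (suf_S HF); apply: suf_z.
Qed.

Definition su_Phi (w : {poly CC} * {poly CC}) : M := su_phi w.1 + u (su_phi w.2).

Lemma su_Phi_lin : linear_map su_Phi.
Proof.
by move=> a [p q] [p' q']; rewrite /su_Phi /= !su_phi_lin !uL; lmod.
Qed.

Lemma su_Phi_inj : injective su_Phi.
Proof.
move=> [p q] [p' q']; rewrite /su_Phi /= => E.
have [] := @su_Im_inj (su_phi (-1 *: p' + p)) (su_phi (-1 *: q' + q)); try exact: suL_phi.
  rewrite !su_phi_lin !uL.
  apply/eqP; rewrite -subr_eq0 -[X in _ - X](subrr (su_phi p + u (su_phi q))) {2}E.
  by apply/eqP; lmod.
move=> /su_phi_eq0 + /su_phi_eq0; rewrite !scaleN1r ![- _ + _]addrC.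
by move=> /subr0_eq -> /subr0_eq ->.
Qed.

Lemma su_Phi_surj x : exists w, su_Phi w = x.
Proof.
have [l1 [l2 [/su_phi_surj[p <-] /su_phi_surj[q <-] ->]]] := su_Im_all x.
by exists (p, q).
Qed.

Lemma su_Phi_s p q :
  s (su_Phi (p, q)) = su_Phi (i *: p + (i - 2%:R) *: q - drop_poly 1 q, - i *: q).
Proof.
rewrite /su_Phi /= !sL su_su !suL_phi uL.
have -> : i *: p + (i - 2%:R) *: q - drop_poly 1 q =
  i *: p + ((i - 2%:R) *: q + ((-1) *: drop_poly 1 q + 0)) by lmod.
have -> : - i *: q = - i *: q + 0 by rewrite addr0.
rewrite !su_phi_lin su_phi_drop -polyC0 su_phiC scale0r !uL (linear_map0 u_lin); lmod.
Qed.

Lemma su_Phi_u p q : u (su_Phi (p, q)) = su_Phi (- q, p + q).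
Proof.
have -> : - q = -1 *: q + 0 by lmod.
have -> : p + q = 1 *: p + q by lmod.
rewrite /su_Phi /= !uL su_u2; by rewrite !su_phi_lin -polyC0 su_phiC !uL; lmod.
Qed.
End Chain.
End Filtered.

Lemma std_act_word (w : bitseq) (g : SL2Z) (v : Vstd) : word_mx w = proj1_sig g ->
  std_act g v = map_mx (fun z : int => z%:~R : CC) (word_mx w) *m v.
Proof. by move=> hw; rewrite /std_act hw. Qed.

Lemma map_mx2_mulE (a b c d : int) (v : Vstd) :
  let w := map_mx (fun z : int => z%:~R : CC) (mx2 a b c d) *m v in
  w 0 0 = a%:~R * v 0 0 + b%:~R * v 1 0 /\ w 1 0 = c%:~R * v 0 0 + d%:~R * v 1 0.
Proof.
by split; rewrite !mxE !big_ord_recl big_ord0 !mxE /= addr0;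
  congr (_ * v _ _ + _ * v _ _); apply: val_inj.
Qed.

(** * T-indecomposability as a bound on the T-fixed vectors *)

Section CGModules.
Variables (M : lmodType CC) (rho : SL2Z -> M -> M).
Hypothesis (HM : is_CGmodule rho).

Lemma cg_linear g : linear_map (rho g).
Proof. by case: HM => h _ _ a x y; apply: h. Qed.

Lemma cg_word g w x : word_mx w = proj1_sig g ->
  rho g x = word_act (rho SL2Z_S) (rho SL2Z_U) w x.
Proof. by case: HM => _ h1 h2; apply: action_word. Qed.

Lemma cg_s4 x : rho SL2Z_S (rho SL2Z_S (rho SL2Z_S (rho SL2Z_S x))) = x.
Proof.
case: HM => _ h1 _; rewrite -[RHS]h1 (@cg_word SL2Z_one [:: true; true; true; true]) //.
by rewrite /word_mx /= mulmx1 !mx2_mul mx2_1; congr mx2.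
Qed.

Lemma cg_u3 x : rho SL2Z_U (rho SL2Z_U (rho SL2Z_U x)) = rho SL2Z_S (rho SL2Z_S x).
Proof.
have [_ _ hM] := HM; rewrite -[RHS]hM.
rewrite (@cg_word (SL2Z_mul SL2Z_S SL2Z_S) [:: false; false; false]) //.
by rewrite /word_mx /= mulmx1 !mx2_mul; congr mx2.
Qed.

Variables (F : nat -> M -> Prop).
Hypothesis HF : V_filtration rho F.

Lemma cg_suf : su_filtration (rho SL2Z_S) (rho SL2Z_U) F.
Proof.
case: HF => Fsub F0 FS Fex Fq; split=> // [n|n x|n x|x|n].
- by case: (Fsub n).
- by case: (Fsub n) => _; apply.
- by case: (Fsub n) => _; apply.
- by move/F0.
have [f [flin fact fsurj fker]] := Fq n.
exists (fun x => f x 0 0), (fun x => f x 1 0); split.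
- by move=> a x y hx hy; rewrite flin // !mxE.
- move=> x hx; rewrite fact // /std_act /= /Smx.
  by have [-> ->] := map_mx2_mulE 0 (-1) 1 0 (f x); split; ring.
- move=> x hx; rewrite fact // /std_act /= /Umx.
  by have [-> ->] := map_mx2_mulE 0 (-1) 1 1 (f x); split; ring.
- move=> a b; have [x hx fx] := fsurj (\col_(j < 2) if j == 0 then a else b).
  by exists x => //; rewrite fx !mxE.
- move=> x hx; rewrite -fker //; split=> [[h0 h1]|->]; last by rewrite !mxE.
  apply/matrixP => j k; rewrite ord1 mxE.
  by case: j => [[|[|j]] hj] //; [rewrite -[RHS]h0|rewrite -[RHS]h1];
    congr (f x _ _); apply: val_inj.
Qed.

Lemma cg_T x : rho T x = - rho SL2Z_S (rho SL2Z_U x).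
Proof.
rewrite (cg_word (g := T) _ word_mx_T) /=.
exact: (su_s2 (cg_linear _) cg_suf cg_s4).
Qed.

Definition ker_T_line : Prop := forall x y, rho T x = x -> rho T y = y ->
  exists a b : CC, (a, b) != (0, 0) /\ a *: x + b *: y = 0.

(** Two independent T-fixed vectors would span a plane that splits into two T-invariant lines. *)
Lemma T_indecomposable_ker : T_indecomposable rho -> ker_T_line.
Proof.
move=> Tind x y Tx Ty; apply: contrapT => nab.
pose line (v w : M) := exists a : CC, w = a *: v.
have line_sub (v : M) : subspace (line v).
  split=> [|a _ _ [b ->] [c ->]]; first by exists 0; rewrite scale0r.
  by exists (a * b + c); lmod.
have line_inv (v : M) : rho T v = v -> Defs.invariant (rho T) (line v).
  by move=> Tv _ [a ->]; exists a; rewrite (linear_mapZ (cg_linear T)) Tv.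
pose W w := exists x1 x2, [/\ line x x1, line y x2 & w = x1 + x2].
have Wsub : subspace W.
  split; first by exists 0, 0; rewrite addr0; split=> //; exists 0; rewrite scale0r.
  move=> a _ _ [_ [_ [[b ->] [c ->] ->]]] [_ [_ [[d ->] [e ->] ->]]].
  exists ((a * b + d) *: x), ((a * c + e) *: y).
  by split; [exists (a * b + d)|exists (a * c + e)|lmod].
have Winv : Defs.invariant (rho T) W.
  move=> _ [x1 [x2 [h1 h2 ->]]]; exists (rho T x1), (rho T x2).
  by rewrite (linear_mapD (cg_linear T)); split=> //; apply: line_inv.
have [Hind _] := Tind W Wsub Winv.
have Wdir : direct_sum W (line x) (line y).
  split=> // w [a ->] [b E]; have [->|a0] := eqVneq a 0; first by rewrite scale0r.
  case: nab; exists a, (- b); rewrite xpair_eqE negb_and a0; split=> //.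
  by rewrite E; lmod.
case: (Hind _ _ (line_sub x) (line_sub y) (line_inv x Tx) (line_inv y Ty) Wdir) => h;
  case: nab.
- exists 1, 0; rewrite xpair_eqE oner_eq0 scale0r addr0 scale1r; split=> //.
  by apply: h; exists 1; rewrite scale1r.
- exists 0, 1; rewrite xpair_eqE oner_eq0 andbF scale0r add0r scale1r; split=> //.
  by apply: h; exists 1; rewrite scale1r.
Qed.

(** By unipotence every nonzero T-invariant subspace contains a nonzero T-fixed vector, so two
    nonzero complementary summands would give two independent ones. *)
Lemma ker_T_indecomposable : ker_T_line -> T_indecomposable rho.
Proof.
move=> kerT W _ _.
have Tnil x : exists k, iter k (fun y => rho T y - y) x = 0.
  have [k hk] := su_unipotent (cg_linear _) (cg_linear _) cg_suf cg_s4 cg_u3 x.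
  by exists k; rewrite -[RHS]hk; apply: eq_iter => y; rewrite cg_T.
split=> [W1 W2 W1sub W2sub W1inv W2inv [_ Wdir]|x _]; last exact: Tnil.
have fixpt V : subspace V -> Defs.invariant (rho T) V -> (forall x, V x -> x = 0) \/
    exists x, [/\ V x, x != 0 & rho T x = x].
  move=> Vsub Vinv; have [h|h] := pselect (forall x, V x -> x = 0); [by left|right].
  have [x Vx x0] := (existsPNP _ _).2 h.
  (* The last nonzero iterate of [T - 1] on x is fixed by T. *)
  have [k] := Tnil x; elim: k x Vx x0 => [//|k IH] x Vx x0; rewrite iterSr => hk.
  have [E|ne] := eqVneq (rho T x - x) 0.
    by exists x; split=> //; [apply/eqP|apply: subr0_eq].
  apply: (IH (rho T x - x)) => //; last exact/eqP.
  by apply: (subspaceD Vsub) => //; [apply: Vinv|apply: (subspaceN Vsub)].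
have [?|[x [Wx x0 Tx]]] := fixpt _ W1sub W1inv; first by left.
have [?|[y [Wy y0 Ty]]] := fixpt _ W2sub W2inv; first by right.
exfalso; have [a [b [ab E]]] := kerT _ _ Tx Ty.
have a0 : a *: x = 0.
  apply: Wdir; first exact: subspaceZ.
  have -> : a *: x = - (b *: y) by apply/eqP; rewrite -addr_eq0 E.
  by apply: (subspaceN W2sub); apply: subspaceZ.
have b0 : b *: y = 0 by rewrite -E a0 add0r.
move/eqP: a0; move/eqP: b0; rewrite !scaler_eq0 (negPf x0) (negPf y0) !orbF.
by move=> /eqP b0 /eqP a0; rewrite a0 b0 eqxx in ab.
Qed.
End CGModules.

(** * The model *)

(* The pair [(p, q)] stands for [p + U q], with [p], [q] in the i-eigenspace of S
   and [z] acting as [drop_poly 1]; see [su_Phi_s] and [su_Phi_u]. *)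
Definition model_s (w : {poly CC} * {poly CC}) : {poly CC} * {poly CC} :=
  ('i *: w.1 + ('i - 2%:R) *: w.2 - drop_poly 1 w.2, - 'i *: w.2).
Definition model_u (w : {poly CC} * {poly CC}) : {poly CC} * {poly CC} :=
  (- w.2, w.1 + w.2).

(** This carries uniqueness: [model_s] and [model_u] do not depend on M. *)
Lemma model_iso (M : lmodType CC) (rho : SL2Z -> M -> M) :
  is_CGmodule rho -> T_indecomposable rho -> has_V_filtration rho ->
  exists Phi : {poly CC} * {poly CC} -> M,
    [/\ linear_map Phi, injective Phi, forall x, exists w, Phi w = x,
        forall w, rho SL2Z_S (Phi w) = Phi (model_s w) &
        forall w, rho SL2Z_U (Phi w) = Phi (model_u w)].
Proof.
move=> HM Tind [F HF].
have sl := cg_linear HM SL2Z_S; have ul := cg_linear HM SL2Z_U.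
have suf := cg_suf HF; have s4 := cg_s4 HM; have u3 := cg_u3 HM.
have kerT := T_indecomposable_ker HM Tind.
have ker1 x y : rho SL2Z_S (rho SL2Z_U x) = - x -> rho SL2Z_S (rho SL2Z_U y) = - y ->
    exists a b : CC, (a, b) != (0, 0) /\ a *: x + b *: y = 0.
  by move=> hx hy; apply: kerT; rewrite (cg_T HM HF) ?hx ?hy opprK.
have i2 : ('i : CC) ^+ 2 = -1 := sqrCi _.
have [e [Le ze0 zeS e0 ker]] := suL_chain sl ul suf s4 u3 ker1 i2.
exists (su_Phi (rho SL2Z_U) e); split.
- exact: su_Phi_lin.
- exact: (su_Phi_inj sl ul suf s4 u3 i2 Le ze0 zeS e0).
- exact: (su_Phi_surj sl ul suf s4 u3 i2 Le ze0 zeS ker).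
- by move=> [p q]; apply: su_Phi_s.
- by move=> [p q]; apply: (su_Phi_u sl ul suf s4 u3).
Qed.

Lemma model_s2 w : model_s (model_s w) = (- w.1, - w.2).
Proof.
have i2 : ('i : CC) ^+ 2 = -1 := sqrCi _.
case: w => p q; rewrite /model_s /= drop_polyZ; move: 'i i2 => i i2.
by congr pair; lmod i2.
Qed.

Lemma model_s4 w : model_s (model_s (model_s (model_s w))) = w.
Proof. by rewrite !model_s2 !opprK; case: w. Qed.

Lemma model_u3 w : model_u (model_u (model_u w)) = model_s (model_s w).
Proof. by rewrite model_s2; case: w => p q; rewrite /model_u /=; congr pair; lmod. Qed.

Lemma pair_linE (a : CC) (p q p' q' : {poly CC}) :
  a *: (p, q) + (p', q') = (a *: p + p', a *: q + q') :> {poly CC} * {poly CC}.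
Proof. by []. Qed.

Lemma model_s_linear : linear_map model_s.
Proof.
move=> a [p q] [p' q']; rewrite /model_s !pair_linE /= drop_polyD drop_polyZ.
by congr pair; lmod.
Qed.

Lemma model_u_linear : linear_map model_u.
Proof. by move=> a [p q] [p' q']; rewrite /model_u !pair_linE /=; congr pair; lmod. Qed.

Definition model_F (n : nat) (w : {poly CC} * {poly CC}) : Prop :=
  (size w.1 <= n)%N /\ (size w.2 <= n)%N.

Lemma size_lin_comb (n : nat) (a b : CC) (p q : {poly CC}) :
  (size p <= n)%N -> (size q <= n)%N -> (size (a *: p + b *: q)%R <= n)%N.
Proof.
move=> hp hq; apply: leq_trans (size_polyD _ _) _; rewrite geq_max.
by rewrite !(leq_trans (size_scale_leq _ _)).
Qed.

Lemma model_F_s n w : model_F n w -> model_F n (model_s w).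
Proof.
case: w => p q [/= hp hq]; split; rewrite /=; last exact: leq_trans (size_scale_leq _ _) hq.
have -> : 'i *: p + ('i - 2%:R) *: q - drop_poly 1 q =
    1 *: ('i *: p + ('i - 2%:R) *: q) + (-1) *: drop_poly 1 q by lmod.
apply: size_lin_comb; first exact: size_lin_comb.
by rewrite size_drop_poly (leq_trans (leq_subr _ _)).
Qed.

Lemma model_F_u n w : model_F n w -> model_F n (model_u w).
Proof.
case: w => p q [/= hp hq]; split; rewrite /= ?size_polyN //.
by rewrite -[p]scale1r -[q]scale1r; apply: size_lin_comb.
Qed.

Lemma model_F_sub n : @subspace ({poly CC} * {poly CC})%type (model_F n).
Proof.
split; first by rewrite /model_F /= size_poly0.
move=> a [p q] [p' q'] [/= hp hq] [/= hp' hq']; split; rewrite /=.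
  by rewrite -[p']scale1r; apply: size_lin_comb.
by rewrite -[q']scale1r; apply: size_lin_comb.
Qed.

(* The top coefficients span a copy of V, embedded by sending the eigenvector
   [(1, 0)] of [model_s] to the eigenvector [(1, - 'i)] of S. *)
Definition model_top (n : nat) (w : {poly CC} * {poly CC}) : Vstd :=
  \col_j if j == 0 then w.1`_n + 'i * w.2`_n
         else - 'i * w.1`_n + (1 - 'i) * w.2`_n.

Lemma colP2 (v w : Vstd) : v 0 0 = w 0 0 -> v 1 0 = w 1 0 -> v = w.
Proof.
move=> h0 h1; apply/matrixP => j k; rewrite ord1.
by case: j => [[|[|j]] hj] //; [move: h0|move: h1]; congr (v _ _ = w _ _); apply: val_inj.
Qed.

Lemma model_top_s n w : model_F n.+1 w ->
  model_top n (model_s w) = map_mx (fun z : int => z%:~R : CC) Smx *m model_top n w.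
Proof.
have i2 : ('i : CC) ^+ 2 = -1 := sqrCi _.
case: w => p q [/= hp hq].
have [E0 E1] := map_mx2_mulE 0 (-1) 1 0 (model_top n (p, q)).
(* The shift lowers the degree, so the z-term of [model_s] is invisible in the top coefficient. *)
have qn : (drop_poly 1 q)`_n = 0 by rewrite coef_drop_poly nth_default // addn1.
apply: colP2; rewrite ?E0 ?E1 !mxE /= ?coefD ?coefN ?qn !coefZ;
move: 'i i2 => i i2; ring: i2.
Qed.

Lemma model_top_u n w :
  model_top n (model_u w) = map_mx (fun z : int => z%:~R : CC) Umx *m model_top n w.
Proof.
have i2 : ('i : CC) ^+ 2 = -1 := sqrCi _.
case: w => p q.
have [E0 E1] := map_mx2_mulE 0 (-1) 1 1 (model_top n (p, q)).
apply: colP2; rewrite ?E0 ?E1 !mxE /= ?coefD ?coefN;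
move: 'i i2 => i i2; ring: i2.
Qed.

(** The presentation turns the two operators into an action, and the filtration by degree has
    quotients V through [model_top]. T-indecomposability follows once the T-fixed vectors are shown
    to form a line. *)
Lemma model_exists : exists (rho : SL2Z -> {poly CC} * {poly CC} -> {poly CC} * {poly CC}),
  [/\ is_CGmodule rho, T_indecomposable rho & has_V_filtration rho].
Proof.
have i2 : ('i : CC) ^+ 2 = -1 := sqrCi _.
have [rho [rho1 rhoM rhoE]] := SL2Z_action model_s4 model_u3.
have rho_lin g : linear_map (rho g).
  have [w hw] := SL2Z_word g; move=> a x y; rewrite !(rhoE g w) //.
  elim: w {hw} => //= b w ->; case: b; [exact: model_s_linear|exact: model_u_linear].
have HM : is_CGmodule rho by split=> // g a x y; apply: rho_lin.
have rhoS x : rho SL2Z_S x = model_s x.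
  by rewrite (rhoE _ [:: true]) // /word_mx /= mulmx1.
have rhoU x : rho SL2Z_U x = model_u x.
  by rewrite (rhoE _ [:: false]) // /word_mx /= mulmx1.
have FG n g x : model_F n x -> model_F n (rho g x).
  have [w hw] := SL2Z_word g; rewrite (rhoE g w) //.
  elim: w {hw} => //= b w IH /IH; case: b; [exact: model_F_s|exact: model_F_u].
have HF : V_filtration rho model_F.
  split=> [n|[p q]|n w [h1 h2]|[p q]|n].
  - by split; [exact: model_F_sub|move=> g x; apply: FG].
  - rewrite /model_F /= !leqn0 !size_poly_eq0; split=> [[/eqP-> /eqP->]//|[-> ->]].
    by rewrite eqxx.
  - by split; apply: leqW.
  - by exists (maxn (size p) (size q)); rewrite /model_F /= leq_maxl leq_maxr.
  exists (model_top n); split.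
  + move=> a [p q] [p' q'] _ _; apply: colP2; rewrite !mxE /= !coefD !coefZ; ring.
  + move=> g x hx; have [w hw] := SL2Z_word g.
    rewrite (rhoE g w) // (std_act_word _ hw) {hw}.
    elim: w => [|b w IH]; first by rewrite /word_mx /= map_mx1 mul1mx.
    have hwx : model_F n.+1 (word_act model_s model_u w x).
      elim: (w) => //= b' w' IH'; case: b'; [exact: model_F_s|exact: model_F_u].
    rewrite /word_mx /= -/(word_mx w).
    by case: b; rewrite ?model_top_s ?model_top_u // map_mxM -mulmxA IH.
  (* These coefficients are the inverse of the matrix of [model_top], with rows [(1, 'i)] and
     [(- 'i, 1 - 'i)] and determinant [- 'i]. *)
  + move=> v; exists ((((1 + 'i) * v 0 0 + v 1 0) *: 'X^n, (-1 * v 0 0 + 'i * v 1 0) *: 'X^n)).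
      by split; rewrite /= (leq_trans (size_scale_leq _ _)) // size_polyXn.
    apply: colP2; rewrite !mxE /= !coefZ coefXn eqxx /=; move: 'i i2 => i i2; ring: i2.
  + move=> [p q] [/= hp hq]; split.
      move=> /matrixP E; move: (E 0 0) (E 1 0); rewrite !mxE /= => E0 E1.
      have q0 : q`_n = 0.
        have -> : q`_n = 'i * ('i * (p`_n + 'i * q`_n) + (- 'i * p`_n + (1 - 'i) * q`_n)).
          by move: 'i i2 {E0 E1} => i i2; ring: i2.
        by rewrite E0 E1 !mulr0 addr0 mulr0.
      have p0 : p`_n = 0 by move: E0; rewrite q0 mulr0 addr0.
      have szlt (r : {poly CC}) : (size r <= n.+1)%N -> r`_n = 0 -> (size r <= n)%N.
        move=> hr r0; apply/leq_sizeP => j; rewrite leq_eqVlt => /orP[/eqP<-//|hj].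
        by rewrite nth_default // (leq_trans hr).
      by split; apply: szlt.
    move=> [/= hp' hq']; apply: colP2; rewrite !mxE /= !nth_default //; ring.
exists rho; split=> //; last by exists model_F.
apply: (ker_T_indecomposable HM HF) => x y.
(* For fixed w, [s u w = - w] gives [u w = s w]. The second coordinate yields [p = - (1 + i) q]; the
   first then reduces to [z q = 0], so q is constant. *)
have fixE w : rho T w = w -> exists c : CC, w = (- (1 + 'i) *: c%:P, c%:P).
  rewrite (cg_T HM HF) rhoS rhoU => E.
  have {}E : model_s (model_u w) = - w by rewrite -[in RHS]E opprK.
  have := congr1 model_s E; rewrite model_s2 {E}.
  have dN (r : {poly CC}) : drop_poly 1 (- r) = - drop_poly 1 r.
    by rewrite -scaleN1r drop_polyZ scaleN1r.
  case: w => p q; rewrite /model_s /= dN => -[E1 E2].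
  move: 'i i2 E1 E2 => i i2 E1 E2.
  have pE : p = - (1 + i) *: q.
    have -> : p = - (- (p + q)) - q by lmod.
    by rewrite E2; lmod.
  have dq : drop_poly 1 q = 0.
    have -> : drop_poly 1 q = (i *: - p + (i - 2%:R) *: - q - - drop_poly 1 q) +
      (i *: p + (i - 2%:R) *: q) by lmod.
    by rewrite -E1 pE; lmod i2.
  have qE : q = (q`_0)%:P.
    apply/polyP => -[|k]; rewrite coefC //=.
    by have := congr1 (fun r : {poly CC} => r`_k) dq; rewrite coef_drop_poly addn1 coef0.
  by exists q`_0; rewrite pE -qE.
move=> /fixE[c ->] /fixE[d ->].
have [->|c0] := eqVneq c 0.
  exists 1, 0; rewrite xpair_eqE oner_eq0 polyC0 scaler0 scale1r scale0r addr0.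
  by split.
exists d, (- c); rewrite xpair_eqE negb_and oppr_eq0 c0 orbT; split=> //.
rewrite -[c%:P]alg_polyC -[d%:P]alg_polyC.
transitivity ((0 : {poly CC}), (0 : {poly CC})) => //.
congr pair; rewrite /=; lmod.
Qed.

Lemma word_act_morph (X Y : Type) (s u : X -> X) (s' u' : Y -> Y) (f : X -> Y) w x :
  (forall y, s' (f y) = f (s y)) -> (forall y, u' (f y) = f (u y)) ->
  word_act s' u' w (f x) = f (word_act s u w x).
Proof. by move=> hs hu; elim: w => //= b w ->; case: b. Qed.

Theorem theorem8p1 :
  (exists (M : lmodType CC) (rho : SL2Z -> M -> M),
      [/\ is_CGmodule rho, T_indecomposable rho & has_V_filtration rho]) /\
  (forall (M1 M2 : lmodType CC) (rho1 : SL2Z -> M1 -> M1) (rho2 : SL2Z -> M2 -> M2),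
      is_CGmodule rho1 -> T_indecomposable rho1 -> has_V_filtration rho1 ->
      is_CGmodule rho2 -> T_indecomposable rho2 -> has_V_filtration rho2 ->
      exists f : M1 -> M2, CGiso rho1 rho2 f).
Proof.
split; first by exists ({poly CC} * {poly CC})%type; exact: model_exists.
move=> M1 M2 rho1 rho2 HM1 HT1 HF1 HM2 HT2 HF2.
have [f1 [lin1 inj1 surj1 s1 u1]] := model_iso HM1 HT1 HF1.
have [f2 [lin2 inj2 surj2 s2 u2]] := model_iso HM2 HT2 HF2.
have [g1 f1K] := choice surj1; have [g2 f2K] := choice surj2.
have g1K : cancel f1 g1 by move=> w; apply: inj1; rewrite f1K.
have g2K : cancel f2 g2 by move=> w; apply: inj2; rewrite f2K.
exists (f2 \o g1); split.
- move=> a x y /=; rewrite -lin2; congr f2.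
  by apply: inj1; rewrite lin1 !f1K.
- by exists (f1 \o g2) => x /=; rewrite ?g2K ?f1K ?g1K ?f2K.
(* Equivariance need only be known for S and U, which [f1] and [f2] both intertwine with the model;
   a word for g does the rest. *)
- move=> g x /=; have [w hw] := SL2Z_word g.
  rewrite (cg_word HM2 _ hw) (word_act_morph _ _ s2 u2); congr f2; apply: inj1.
  by rewrite f1K -(word_act_morph _ _ s1 u1) -(cg_word HM1 _ hw) f1K.
Qed.
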